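(* For any tree $T$ with at least three vertices, $\kappa(T)\ge 2$.
   Context: $d_T$ is the shortest-path distance. For $S\subseteq V(T)$ and $x\in V(T)$, $m(x|S)$ is the multiset $\{\!\{d_T(x,s): s\in S\}\!\}$. A nonempty set $S\subsetneq V(T)$ is a $k$-multiset antiresolving set ($k$-MARS) if $k$ equals the minimum size of an equivalence class of the relation on $V(T)\setminus S$ given by $x\sim y \iff m(x|S)=m(y|S)$. $\kappa(T)$ denotes the largest integer $k$ such that $T$ contains a $k$-MARS. *)

(* Defs.v *)
From mathcomp Require Import all_boot.
From mathcomp Require Import finmap multiset.

Set Implicit Arguments.
Unset Strict Implicit.
Unset Printing Implicit Defensive.

Local Open Scope mset_scope.
Local Open Scope nat_scope.

Section Graph.

Variables (V : finType) (e : rel V).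

Definition simple_graph : Prop := symmetric e /\ irreflexive e.

Definition connected : Prop := forall x y : V, connect e x y.

(* [ucycle e c] also holds for the empty sequence and for an edge traversed
   back and forth, hence the bound on the size. *)
Definition acyclic : Prop := forall c : seq V, ucycle e c -> size c < 3.

Definition is_tree : Prop := [/\ simple_graph, connected & acyclic].

Definition walk (n : nat) (x y : V) : bool :=
  [exists p : n.-tuple V, path e x p && (last x p == y)].

(* The least length of a walk from [x] to [y]; the lengths below #|V| suffice,
   and the value is #|V| if [y] is not reachable from [x]. *)
Definition dist (x y : V) : nat := find (fun n => walk n x y) (iota 0 #|V|).

Definition mrep (S : {set V}) (x : V) : {mset nat} :=
  seq_mset [seq dist x s | s <- enum S].

Definition mclasses (S : {set V}) : {set {set V}} :=
  equivalence_partition (fun x y => mrep S x == mrep S y) (~: S).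

Definition is_kMARS (k : nat) (S : {set V}) : bool :=
  [&& S != set0, S \proper [set: V],
      [exists C in mclasses S, #|C| == k] &
      [forall C in mclasses S, k <= #|C|]].

(* A class has at most #|V| elements, so bounding [k] loses nothing. *)
Definition kappa : nat :=
  \max_(k < #|V|.+1 | [exists S : {set V}, is_kMARS k S]) k.

Lemma walkP n x y :
  reflect (exists p : seq V, [/\ size p = n, path e x p & last x p = y])
          (walk n x y).
Proof.
apply: (iffP existsP) => [[p /andP[xp /eqP yp]]|[p [sp xp yp]]].
  by exists p; rewrite size_tuple.
by exists (tcast sp (in_tuple p)); rewrite val_tcast /= xp yp eqxx.
Qed.

Lemma connect_walk x y : connect e x y -> exists2 n, n < #|V| & walk n x y.
Proof.
case/connectP => p xp ->; case: (shortenP xp) => q xq uq _.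
exists (size q); last by apply/walkP; exists q.
by have /card_uniqP/= <- := uq; apply: max_card.
Qed.

Lemma walk_dist x y : connect e x y -> walk (dist x y) x y.
Proof.
case/connect_walk => n ltn xy.
have h : has (fun n => walk n x y) (iota 0 #|V|).
  by apply/hasP; exists n => //; rewrite mem_iota.
have := nth_find 0 h; rewrite nth_iota //.
by move: h; rewrite has_find size_iota.
Qed.

Lemma dist_min x y n : walk n x y -> dist x y <= n.
Proof.
move=> xy; rewrite leqNgt; apply/negP => lt_n.
have ltV : n < #|V|.
  by apply: leq_trans lt_n _; rewrite -[X in _ <= X](size_iota 0) find_size.
by have := before_find 0 lt_n; rewrite nth_iota // add0n xy.
Qed.

Lemma mem_mclasses (S C : {set V}) :
  reflect (exists2 x, x \notin S &
             C = [set y in ~: S | mrep S x == mrep S y])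
          (C \in mclasses S).
Proof.
apply: (iffP imsetP) => -[x xS ->]; exists x => //; first by rewrite inE in xS.
by rewrite inE.
Qed.

Lemma kMARS_le_kappa k S : is_kMARS k S -> k <= kappa.
Proof.
move=> kS; have kV : k < #|V|.+1.
  case/and4P: kS => _ _ /exists_inP[C _ /eqP <-] _.
  by rewrite ltnS max_card.
apply: (bigmax_sup (Ordinal kV)) => //.
by apply/existsP; exists S.
Qed.

Lemma kMARS_exists (S : {set V}) :
  S != set0 -> S \proper [set: V] -> exists k, is_kMARS k S.
Proof.
move=> S0 ST; case/properP: (ST) => _ [x _ xS].
pose C0 := [set y in ~: S | mrep S x == mrep S y].
have C0S : C0 \in mclasses S by apply/mem_mclasses; exists x.
case: (arg_minnP (fun C : {set V} => #|C|) C0S) => C CS Cmin.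
exists #|C|; apply/and4P; split => //.
  by apply/exists_inP; exists C.
by apply/forall_inP.
Qed.

Lemma kappa_kMARS : 1 < #|V| -> exists S, is_kMARS kappa S.
Proof.
move=> V1; have /card_gt0P[x _] : 0 < #|V| by apply: ltnW.
have [||k kS] := @kMARS_exists [set x].
- by apply/set0Pn; exists x; rewrite set11.
- by rewrite properEcard subsetT cards1 cardsT.
have kV : k < #|V|.+1.
  case/and4P: kS => _ _ /exists_inP[C _ /eqP <-] _.
  by rewrite ltnS max_card.
pose P (i : 'I_#|V|.+1) := [exists S : {set V}, is_kMARS i S].
have Pk : P (Ordinal kV) by apply/existsP; exists [set x].
rewrite /kappa -/P (@bigmax_eq_arg _ (Ordinal kV) P) //.
by case: arg_maxnP => // i /existsP.
Qed.

End Graph.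

(* Main.v *)
Require Import Defs.
From mathcomp Require Import all_boot.
From mathcomp Require Import multiset zify.

Set Implicit Arguments.
Unset Strict Implicit.
Unset Printing Implicit Defensive.

(** Let [c] be a vertex of minimal eccentricity. If no vertex other than [c] is
    alone at its distance from [c], then [{c}] works. Otherwise let [w] be such
    a lone vertex and [c'] the neighbour of [c] on a geodesic to [w]. A geodesic
    from [c] to a vertex at least as far as [w] runs through [w], so the
    eccentricity of [c'] is at most, hence equal to, that of [c], and [{c, c'}]
    works: trees being bipartite, the distances of [x] to [c] and [c'] are [k]
    and [k + 1] in some order, and for each such [k] both orders occur, one on a
    longest geodesic from [c] and the other on a longest geodesic from [c']. *)

Definition odd_cycle_free (V : finType) (e : rel V) : Prop :=
  forall s : seq V, ucycle e s -> ~~ odd (size s).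

Lemma tree_odd_cycle_free (V : finType) (e : rel V) :
  is_tree e -> odd_cycle_free e.
Proof.
case=> -[_ irr_e] _ acyc_e s cyc_s; have := acyc_e s cyc_s.
by case: s cyc_s => [|x [|y []]] //=; rewrite /ucycle /= irr_e.
Qed.

Section Distance.

Variables (V : finType) (e : rel V).
Implicit Types (x y z : V) (p q : seq V).

Local Notation d := (dist e).

Lemma dist_le_size x p : path e x p -> d x (last x p) <= size p.
Proof. by move=> xp; apply/dist_min/walkP; exists p. Qed.

Lemma distxx x : d x x = 0.
Proof. by apply/eqP; rewrite -leqn0 (@dist_le_size x [::]). Qed.

Definition geodesic x p : Prop := path e x p /\ size p = d x (last x p).

Lemma geodesic_uniq x p : geodesic x p -> uniq (x :: p).
Proof.
case=> xp; case: (shortenP xp) => q xq uq qp size_p.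
apply: (leq_size_uniq uq); last by rewrite /= ltnS size_p dist_le_size.
by move=> z; rewrite !inE => /predU1P[->|/qp->]; rewrite ?eqxx ?orbT.
Qed.

Definition ecc x : nat := \max_y d x y.

Lemma dist_ecc x y : d x y <= ecc x.
Proof. exact: leq_bigmax. Qed.

Lemma ecc_dist x : exists y, d x y = ecc x.
Proof.
have V_gt0 : 0 < #|V| by apply/card_gt0P; exists x.
by have [y max_y] := eq_bigmax (d x) V_gt0; exists y.
Qed.

Hypothesis conn_e : connected e.

Lemma geodesic_exists x y : exists2 p, geodesic x p & last x p = y.
Proof.
have /walkP[p [size_p xp py]] := walk_dist (conn_e x y).
by exists p => //; split; rewrite // py.
Qed.

Lemma dist_eq0 x y : (d x y == 0) = (x == y).
Proof.
apply/eqP/eqP => [xy0|->]; last exact: distxx.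
have [p [_ size_p] py] := geodesic_exists x y.
by rewrite py xy0 in size_p; rewrite -py (size0nil size_p).
Qed.

Lemma dist_triangle y x z : d x z <= d x y + d y z.
Proof.
have [p [xp size_p] py] := geodesic_exists x y.
have [q [yq size_q] qz] := geodesic_exists y z.
rewrite -qz -py in yq size_q *; rewrite -size_q -size_p -size_cat -last_cat.
by rewrite dist_le_size // cat_path xp.
Qed.

Lemma geodesic_cat x p q :
  geodesic x (p ++ q) -> geodesic x p /\ geodesic (last x p) q.
Proof.
rewrite /geodesic cat_path last_cat size_cat => -[/andP[xp yq] size_pq].
have := dist_triangle (last x p) x (last (last x p) q).
by have := dist_le_size xp; have := dist_le_size yq; do !split => //; lia.
Qed.

Lemma geodesic_mem x p z : geodesic x p -> z \in x :: p ->
  d x (last x p) = d x z + d z (last x p).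
Proof.
move=> geo_p zp; case/splitPl: zp geo_p => q r <- geo_qr.
have [[_ size_q] [_ size_r]] := geodesic_cat geo_qr.
by rewrite last_cat -size_q -size_r -size_cat -last_cat; case: geo_qr.
Qed.

Lemma geodesic_point x y k : k <= d x y ->
  exists2 z, d x z = k & d x y = k + d z y.
Proof.
have [p geo_p <-] := geodesic_exists x y; have [_ <-] := geo_p => le_k.
move: geo_p; rewrite -{1}(cat_take_drop k p) => /geodesic_cat[[_ size_take]].
rewrite /geodesic -last_cat cat_take_drop size_drop => -[_ size_drop].
exists (last x (take k p)); first by rewrite -size_take size_takel.
by rewrite -size_drop subnKC.
Qed.

Lemma geodesic_neighbour x y : x != y -> exists2 z, e x z & d x y = (d z y).+1.
Proof.
have [[|z p] geo_p <-] := geodesic_exists x y; first by rewrite eqxx.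
have [_ [_ size_p]] := @geodesic_cat x [:: z] p geo_p.
by case: geo_p => /andP[xz _] <-; exists z; rewrite //= -size_p.
Qed.

Lemma dist_neighbour x y z : e x y -> d x z <= (d y z).+1.
Proof.
move=> xy; apply: leq_trans (dist_triangle y x z) _.
by rewrite -add1n leq_add2r (@dist_le_size x [:: y]) //= xy.
Qed.

Hypothesis sym_e : symmetric e.

Lemma dist_sym x y : d x y = d y x.
Proof.
suff dist_le a b : d a b <= d b a by apply/eqP; rewrite eqn_leq !dist_le.
have [p [bp size_p] <-] := geodesic_exists b a; rewrite -size_p.
have rev_p : path e (last b p) (rev (belast b p)).
  by rewrite rev_path (eq_path (e' := e)).
have := dist_le_size rev_p; rewrite size_rev size_belast.
by rewrite -(last_cons b (last b p)) -rev_rcons -lastI rev_cons last_rcons.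
Qed.

Hypothesis no_odd : odd_cycle_free e.

(* The vertex [y] equidistant from [c] and [c'] and closest to them closes an
   odd cycle with geodesics to [c] and [c'], which meet only in [y]. *)
Lemma neighbour_dist_neq c c' x : e c c' -> d c x != d c' x.
Proof.
move=> cc'; apply/negP=> eq_x.
have [y /eqP eq_y min_y] :=
  @arg_minnP _ x (fun y => d c y == d c' y) (d c) eq_x.
have [p geo_p py] := geodesic_exists c y.
have [q geo_q qc'] := geodesic_exists y c'.
have [[cp size_p] [yq size_q]] := (geo_p, geo_q).
suff /no_odd : ucycle e ((c :: p) ++ q).
  rewrite size_cat /= size_p size_q py qc' (dist_sym y) -eq_y.
  by rewrite addnn odd_double.
apply/andP; split.
  by rewrite /= rcons_cat cat_path cp py rcons_path yq qc' sym_e.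
have := geodesic_uniq geo_q; rewrite cons_uniq => /andP[y_notin_q uniq_q].
rewrite cat_uniq (geodesic_uniq geo_p) uniq_q andbT; apply/hasPn=> z zq.
apply/negP=> zp; have zy : d z y != 0.
  by rewrite dist_eq0; apply: contraNneq y_notin_q => <-.
have cz : d c y = d c z + d z y by rewrite -py (geodesic_mem geo_p zp).
have c'z : d c' y = d z y + d c' z.
  rewrite !(dist_sym c') (dist_sym z) -qc'; apply: (geodesic_mem geo_q).
  by rewrite in_cons zq orbT.
by have := min_y z; lia.
Qed.

(* If [x] is closer to [c], then [y] can be found on a geodesic from [c'] to a
   vertex farthest from [c]. *)
Lemma swap_dist c c' x : e c c' -> ecc c = ecc c' ->
  exists y, d c y = d c' x /\ d c' y = d c x.
Proof.
wlog lt_x : c c' / d c x < d c' x => [swap cc' eq_ecc|cc' eq_ecc].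
  have [lt_x|gt_x|eq_x] := ltngtP (d c x) (d c' x); first exact: swap.
    by have [||y []] := swap c' c gt_x; rewrite 1?sym_e //; exists y.
  by have := neighbour_dist_neq x cc'; rewrite eq_x eqxx.
have c'c : e c' c by rewrite sym_e.
have [w far_w] := ecc_dist c.
have c'w : (d c' w).+1 = d c w.
  have := neighbour_dist_neq w cc'; have := dist_ecc c' w.
  by have := dist_neighbour w cc'; lia.
have [|y c'y yw] := @geodesic_point c' w (d c x).
  by have := dist_ecc c' x; lia.
exists y; split=> //.
have := dist_triangle y c w; have := dist_neighbour y cc'.
by have := dist_neighbour x c'c; lia.
Qed.

End Distance.

Section Kappa.

Variables (V : finType) (e : rel V).
Implicit Types (c x y w : V).

Local Notation d := (dist e).

Lemma leq_kappa (S : {set V}) k : S != set0 -> S \proper [set: V] ->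
  (forall C, C \in mclasses e S -> k <= #|C|) -> k <= kappa e.
Proof.
move=> S_neq0 S_proper le_k; have [m mS] := kMARS_exists e S_neq0 S_proper.
apply: leq_trans (kMARS_le_kappa mS).
by case/and4P: mS => _ _ /exists_inP[C /le_k ? /eqP <-].
Qed.

Lemma mrep_seq (s : seq V) x : uniq s ->
  mrep e [set:: s] x = seq_mset [seq d x z | z <- s].
Proof.
move=> uniq_s; apply/eq_seq_msetP/perm_map/uniq_perm; rewrite ?enum_uniq //.
by move=> z; rewrite mem_enum inE.
Qed.

Lemma kappa_ge2_twins (s : seq V) : uniq s -> 0 < size s < #|V| ->
  (forall x, x \notin s -> exists y, [/\ y \notin s, y != x &
     perm_eq [seq d x z | z <- s] [seq d y z | z <- s]]) ->
  2 <= kappa e.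
Proof.
move=> uniq_s /andP[s_gt0 s_ltV] twins.
have card_s : #|[set:: s]| = size s by rewrite cardsE; apply/card_uniqP.
apply: (@leq_kappa [set:: s]).
- by rewrite -card_gt0 card_s.
- by rewrite properEcard subsetT cardsT card_s.
move=> _ /mem_mclasses[x x_notin_s ->]; rewrite inE in x_notin_s.
have [y [y_notin_s yx /eq_seq_msetP eq_xy]] := twins x x_notin_s.
apply/card_gt1P; exists y, x; split=> //.
all: by rewrite !inE ?x_notin_s ?y_notin_s ?mrep_seq ?eq_xy /=.
Qed.

Definition lone c w : bool := [forall y, (d c y == d c w) ==> (y == w)].

Lemma loneP c w : reflect (forall y, d c y = d c w -> y = w) (lone c w).
Proof.
apply: (iffP forallP) => [lone_w y /eqP eq_y|lone_w y].
  exact/eqP/(implyP (lone_w y)).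
by apply/implyP=> /eqP/lone_w->.
Qed.

Hypotheses (conn_e : connected e) (sym_e : symmetric e).

Lemma kappa_ge2_no_lone c : 1 < #|V| -> (forall w, w != c -> ~~ lone c w) ->
  2 <= kappa e.
Proof.
move=> V_gt1 no_lone; apply: (@kappa_ge2_twins [:: c]) => // x.
rewrite inE => xc; have := no_lone x xc; rewrite negb_forall => /existsP[y].
rewrite negb_imply => /andP[/eqP eq_y yx]; exists y; split=> //.
  by rewrite inE eq_sym -(dist_eq0 conn_e) eq_y dist_eq0 // eq_sym.
by rewrite /= !(dist_sym conn_e sym_e _ c) eq_y.
Qed.

Lemma lone_neighbour_ecc c w : w != c -> lone c w ->
  exists2 c', e c c' & ecc e c' <= ecc e c.
Proof.
move=> wc /loneP lone_w; rewrite eq_sym in wc.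
have [c' cc' c'w] := geodesic_neighbour conn_e wc.
exists c' => //; apply/bigmax_leqP=> x _.
have [far_x|near_x] := leqP (d c w) (d c x).
  have [_ /lone_w -> wx] := geodesic_point conn_e far_x.
  by have := dist_triangle conn_e w c' x; have := dist_ecc e c x; lia.
have c'c : e c' c by rewrite sym_e.
by have := dist_neighbour conn_e x c'c; have := dist_ecc e c w; lia.
Qed.

Hypothesis no_odd : odd_cycle_free e.

Lemma kappa_ge2_edge_eq_ecc c c' : 2 < #|V| -> e c c' -> ecc e c = ecc e c' ->
  2 <= kappa e.
Proof.
move=> V_gt2 cc' eq_ecc.
have neq_dist x := neighbour_dist_neq conn_e sym_e no_odd x cc'.
have neq_cc' : c != c' by apply: contraNneq (neq_dist c) => <-.
apply: (@kappa_ge2_twins [:: c; c']); rewrite //= ?inE ?neq_cc' // => x.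
have notinE z : (z \notin [:: c; c']) = (d c z != 0) && (d c' z != 0).
  by rewrite !inE negb_or !dist_eq0 // ![z == _]eq_sym.
have [y [cy c'y]] := swap_dist conn_e sym_e no_odd x cc' eq_ecc.
rewrite notinE => x_notin; exists y; split.
- by rewrite notinE cy c'y andbC.
- by apply: contraNneq (neq_dist x) => eq_yx; rewrite -cy eq_yx.
rewrite !(dist_sym conn_e sym_e _ c) !(dist_sym conn_e sym_e _ c') cy c'y.
by rewrite (perm_catC [:: d c x]).
Qed.

Lemma kappa_ge2_odd_cycle_free : 2 < #|V| -> 2 <= kappa e.
Proof.
move=> V_gt2; have /card_gt0P[c0 _] : 0 < #|V| by lia.
have [c _ min_c] := arg_minnP (ecc e) (isT : predT c0).
have [/existsP[w /andP[wc lone_w]]|no_lone] :=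
    boolP [exists w, (w != c) && lone c w].
  have [c' cc' ecc_c'] := lone_neighbour_ecc wc lone_w.
  by apply: (kappa_ge2_edge_eq_ecc V_gt2 cc'); apply/eqP; rewrite eqn_leq min_c.
apply: (@kappa_ge2_no_lone c (ltnW V_gt2)) => w wc.
by apply: contraNN no_lone => lone_w; apply/existsP; exists w; rewrite wc.
Qed.

End Kappa.

Theorem theorem6 (V : finType) (e : rel V) (treeT : is_tree e)
  (card_V : 3 <= #|V|) : 2 <= kappa e.
Proof.
have [[sym_e _] conn_e _] := treeT.
exact: kappa_ge2_odd_cycle_free conn_e sym_e (tree_odd_cycle_free treeT) card_V.
Qed.
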